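(* Let $(X,\tau)$ be a metrizable space. Then $\mathsf{S}_{\mathrm{bnd}}(\mathcal{O},\mathcal{O})$ holds over $X$ if, and only if, there are a compact set $K\subset X$ and a set $N\subset X$ that has strong measure zero with respect to every metric on $X$ that generates the topology $\tau$, such that $X=K\cup N$.
   Context: Here $\omega=\{0,1,2,\dots\}$ and $\mathcal{O}$ denotes the set of open covers of $X$. $\mathsf{S}_{\mathrm{bnd}}(\mathcal{O},\mathcal{O})$ holds if for every sequence $\langle A_n:n\in\omega\rangle$ of elements of $\mathcal{O}$ there are a sequence $\langle B_n:n\in\omega\rangle$ and a $k\in\omega$ such that $B_n\subset A_n$ is finite with $|B_n|\le k$ for every $n\in\omega$, and $\bigcup_{n\in\omega}B_n\in\mathcal{O}$. A subset $N$ of a metric space $(X,d)$ has strong measure zero (with respect to $d$) if for every sequence $\langle\varepsilon_n:n\in\omega\rangle$ of positive reals there is a sequence $\langle N_n:n\in\omega\rangle$ of subsets of $X$ such that $N\subset\bigcup_{n\in\omega}N_n$ and the $d$-diameter of $N_n$ is less than $\varepsilon_n$ for every $n\in\omega$. *)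

(* Defs.v *)
From HB Require Import structures.
From mathcomp Require Import all_boot all_order all_algebra.
From mathcomp Require Import all_classical all_reals all_analysis.

Set Implicit Arguments.
Unset Strict Implicit.
Unset Printing Implicit Defensive.

Import Order.TTheory GRing.Theory Num.Theory.

Local Open Scope classical_set_scope.
Local Open Scope card_scope.
Local Open Scope ring_scope.

(* Metrics are handled as bare functions, not as a [metricType], because the
   result quantifies over all the metrics generating one fixed topology. *)
Definition is_metric (R : realType) (X : Type) (d : X -> X -> R) : Prop :=
  [/\ forall x y, 0 <= d x y,
      forall x y, d x y = 0 <-> x = y,
      forall x y, d x y = d y x
    & forall x y z, d x z <= d x y + d y z].

Definition generates_topology (R : realType) (X : topologicalType)
    (d : X -> X -> R) : Prop :=
  forall A : set X,
    open A <->
    (forall x, A x -> exists2 e : R, 0 < e & [set y | d x y < e] `<=` A).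

Definition metrizable (R : realType) (X : topologicalType) : Prop :=
  exists d : X -> X -> R, is_metric d /\ generates_topology d.

(* [maxe 0] only matters for the empty set, since [ereal_sup set0 = -oo]. *)
Definition diameter (R : realType) (X : Type) (d : X -> X -> R) (A : set X)
    : \bar R :=
  maxe 0%E (ereal_sup [set (d x y)%:E | x in A & y in A]).

Definition strong_measure_zero (R : realType) (X : Type) (d : X -> X -> R)
    (N : set X) : Prop :=
  forall eps : nat -> R, (forall n, 0 < eps n) ->
  exists F : nat -> set X,
    N `<=` \bigcup_n F n /\ forall n, (diameter d (F n) < (eps n)%:E)%E.

Definition open_covers (X : topologicalType) : set (set (set X)) :=
  [set U | (forall V, U V -> open V) /\ \bigcup_(V in U) V = [set: X]].

Definition S_bnd (T : Type) (A B : set (set T)) : Prop :=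
  forall U : nat -> set T, (forall n, A (U n)) ->
  exists (V : nat -> set T) (k : nat),
    (forall n, [/\ V n `<=` U n, finite_set (V n) & V n #<= `I_k]) /\
    B (\bigcup_n V n).

(* Main.v *)
Require Import Defs.
From HB Require Import structures.
From mathcomp Require Import all_boot all_order all_algebra.
From mathcomp Require Import all_classical all_reals all_analysis.
From mathcomp Require Import ring lra.

Local Open Scope classical_set_scope.
Local Open Scope ring_scope.

Import Order.TTheory GRing.Theory Num.Theory.

(** The bridge between the two sides is the relative Rothberger property of a
    subset [N] of [X]: from every sequence of open covers of [X] one can pick a
    single member per cover so that the picked sets cover [N]
    ([rothberger_in]). The theorem splits into two equivalences.

    First, in a metrizable space [N] is Rothberger in [X] if and only if it has
    strong measure zero for every compatible metric. If it is Rothberger, one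
    applies the property to the covers by open sets of diameter at most
    [eps n / 2]. Conversely, given open covers [U n], there is a compatible
    metric for which, for each [n], all the balls of some fixed radius [r n]
    are inside members of [U n] ([covers_uniform_metric]); strong measure zero
    for that metric and the radii [r n] gives the selection. The metric comes
    from a partition-of-unity style rescaling. For a metric [d], let
    [l_U x <= 1] be the Lebesgue radius of [U] at [x], the supremum of the
    [r <= 1] such that the ball of radius [r] about [x] is inside a member of
    [U], and let [l_V] be the one computed with [V] alone. These functions are
    [d]-Lipschitz and [l_U] is the supremum of the [l_V], so the quotients
    [l_V / l_U] have supremum [1] at every point; hence the pseudometric
    [sup_V |l_V x / l_U x - l_V y / l_U y|] is continuous and its balls of
    radius [1/2] are inside members of [U]. Weighting these pseudometrics by
    [1 / (n + 1)] and adding their supremum to [d] gives the wanted metric.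

    Secondly, bounded selections exist if and only if [X] is the union of a
    compact set [K] and a set [N] that is Rothberger in [X]. If [X] is such a
    union, one takes a finite part of the first cover to cover [K] and one
    member of each cover for [N]. Conversely, let [N] be the union of the open
    sets that are Rothberger in [X] and [K] its complement. The set [N] is
    itself Rothberger, because bounded selections make every open cover have a
    countable subcover and a countable union of Rothberger sets is Rothberger.
    If the closed set [K] were not compact, it would contain a sequence whose
    points have a locally finite family of open neighbourhoods [G i], none of
    which is Rothberger. But bounded selections forbid such a family
    ([S_bnd_locally_finite]): if [A i] is a sequence of covers that defeats
    single selections on [G i], then grouping it into blocks of length [i + 1]
    and refining each block gives covers that defeat selections of [i] sets,
    and local finiteness allows all these refinements to be amalgamated into
    one sequence of covers of [X], which defeats every bound. *)

(** * Metric balls and countable families *)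

Definition dball {R : realType} {X : Type} (d : X -> X -> R) (x : X) (r : R)
    : set X := [set y | d x y < r].

Lemma dball_center {R : realType} {X : Type} (d : X -> X -> R) (x : X) (r : R) :
  is_metric d -> 0 < r -> dball d x r x.
Proof. by case=> _ d0 _ _ r0; rewrite /dball /= (d0 x x).2. Qed.

Lemma open_dball {R : realType} {X : topologicalType} (d : X -> X -> R)
    (x : X) (r : R) :
  is_metric d -> generates_topology d -> open (dball d x r).
Proof.
case=> _ _ _ tri gen; apply/gen => y xy; exists (r - d x y).
  by rewrite subr_gt0.
by move=> z /= yz; rewrite /dball /=; have := tri x y z; lra.
Qed.

Lemma invS_lt {R : realType} (e : R) : 0 < e ->
  exists m : nat, forall n, (m <= n)%N -> n.+1%:R^-1 < e.
Proof.
move=> e0; have [m _ hm] := near_infty_natSinv_lt (PosNum e0).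
by exists m => n /hm.
Qed.

Lemma open_bigcap_nat {X : topologicalType} (W : nat -> set X) (m : nat) :
  (forall i, open (W i)) -> open (\bigcap_(i < m) W i).
Proof.
move=> oW; rewrite bigcap_mkord; elim/big_ind: _ => [|? ? ? ?|//].
  exact: openT.
exact: openI.
Qed.

(** Indices that enumerate nothing are sent to the empty set, so that the
    enumeration exists for empty families too. *)
Lemma card_le_nat_enum {X : Type} (V : set (set X)) (B : set nat) :
  (V #<= B)%card ->
  exists e : nat -> set X, (forall j, e j = set0 \/ V (e j)) /\
    forall W, V W -> exists2 j, B j & e j = W.
Proof.
move=> /pcard_surjP[g gs].
exists (fun j => if `[< V (g j) >] then g j else set0); split=> [j|W VW].
  by case: asboolP; [right|left].
have [j Bj gj] := gs W VW; exists j => //.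
by rewrite gj; case: asboolP.
Qed.

(** Compactness being stated with filters, the cover is turned into the filter
    generated by the traces on [K] of the complements of its finite unions; it
    is proper exactly when there is no finite subcover. *)
Lemma compact_finite_subcover {X : topologicalType} (K : set X)
    (U : set (set X)) :
  compact K -> (forall V, U V -> open V) -> K `<=` \bigcup_(V in U) V ->
  exists D : set (set X), [/\ D `<=` U, finite_set D & K `<=` \bigcup_(V in D) V].
Proof.
move=> cK Uo KU; apply: contrapT => noD.
pose F := [set A : set X | exists D : set (set X),
  [/\ D `<=` U, finite_set D & K `\` \bigcup_(V in D) V `<=` A]].
have PF : ProperFilter F.
  split.
    case=> D [DU Df KD]; apply: noD; exists D; split=> // x Kx.
    by apply: contrapT => nx; apply: (KD x).
  split.
  - by exists set0; split => //; exact: finite_set0.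
  - move=> A B [D [DU Df KD]] [D' [DU' Df' KD']]; exists (D `|` D'); split.
    + by move=> V [/DU|/DU'].
    + by rewrite finite_setU.
    + move=> x [Kx nx]; split; [apply: KD|apply: KD']; split=> // -[V DV Vx].
        by apply: nx; exists V => //; left.
      by apply: nx; exists V => //; right.
  - by move=> A B AB [D [DU Df KD]]; exists D; split=> // x /KD /AB.
have FK : F K by exists set0; split => //; exact: finite_set0.
have [x [Kx clx]] := cK F PF FK.
have [V UV Vx] := KU x Kx.
have FV : F (K `\` V).
  exists [set V]; split; [by move=> _ ->|exact: finite_set1|].
  by rewrite bigcup_set1.
have [y [[_ nVy] Vy]] := clx _ V FV (open_nbhs_nbhs (conj (Uo _ UV) Vx)).
exact: nVy.
Qed.

(** * The relative Rothberger property *)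

(** The selected sets are only required to be inside members of the covers, and
    may be empty, which makes the property hereditary at once and meaningful
    for the empty cover of the empty space. *)
Definition rothberger_in {X : topologicalType} (M : set X) : Prop :=
  forall U : nat -> set (set X), (forall n, open_covers (U n)) ->
  exists F : nat -> set X, M `<=` \bigcup_n F n /\
    forall n, F n = set0 \/ exists2 W, U n W & F n `<=` W.

Lemma rothberger_in_sub {X : topologicalType} (M N : set X) :
  N `<=` M -> rothberger_in M -> rothberger_in N.
Proof.
move=> NM rM U Uc; have [F [MF FU]] := rM U Uc.
by exists F; split=> // x /NM /MF.
Qed.

Lemma rothberger_in0 {X : topologicalType} : rothberger_in (@set0 X).
Proof. by move=> U Uc; exists (fun=> set0); split=> // n; left. Qed.

(** The given sequence of covers is split into countably many subsequences, one
    for each set of the union. *)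
Lemma rothberger_in_bigcup {X : topologicalType} {T : countType}
    (M : T -> set X) :
  (forall t, rothberger_in (M t)) -> rothberger_in (\bigcup_t M t).
Proof.
move=> rM U Uc.
have [F hF] := choice (fun t => rM t (fun n => U (pickle (t, n))) (fun n => Uc _)).
exists (fun m => if pickle_inv m is Some p then F p.1 p.2 else set0); split.
  move=> x [t _] /(hF t).1[n _ Fx]; exists (pickle (t, n)) => //.
  by rewrite pickleK_inv.
move=> m; have := pickle_invK (T := (T * nat)%type) m.
case: pickle_inv => [[t n]|] /= hm; last by left.
by rewrite -hm; apply: (hF t).2.
Qed.

Lemma rothberger_strong_measure_zero {R : realType} {X : topologicalType}
    (d : X -> X -> R) (N : set X) :
  is_metric d -> generates_topology d -> rothberger_in N ->
  strong_measure_zero d N.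
Proof.
move=> dm dg rN eps eps0.
pose U n := [set Q : set X | open Q /\
  forall x y, Q x -> Q y -> d x y <= eps n / 2].
have Uc n : open_covers (U n).
  split=> [V []//|]; rewrite -subTset => x _.
  exists (dball d x (eps n / 4)).
    split=> [|y z]; first exact: open_dball.
    case: dm => _ _ sym tri; rewrite /dball /= => xy xz.
    by have := tri y x z; rewrite (sym y x); lra.
  by apply: dball_center => //; rewrite divr_gt0.
have [F [NF FU]] := rN U Uc.
exists F; split=> // n.
have e2 : eps n / 2 < eps n by have := eps0 n; lra.
apply: (@le_lt_trans _ _ (eps n / 2)%:E); last by rewrite lte_fin.
rewrite /diameter ge_max lee_fin divr_ge0 ?(ltW (eps0 n))//=.
apply: ge_ereal_sup => _ [x Fx [y Fy <-]]; rewrite lee_fin.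
have [F0|[W [_ Ws] FW]] := FU n; first by move: Fx; rewrite F0.
by apply: Ws; exact: FW.
Qed.

(** * Consequences of bounded selections *)

(** Bounded selections are applied to a constant sequence of covers. *)
Lemma S_bnd_countable_subcover {X : topologicalType} (U : set (set X)) :
  S_bnd (@open_covers X) (@open_covers X) -> open_covers U ->
  exists e : nat -> set X,
    (forall n, e n = set0 \/ U (e n)) /\ \bigcup_n e n = [set: X].
Proof.
move=> bnd Uc; have [V [k [hV [_ Vc]]]] := bnd (fun=> U) (fun=> Uc).
have cV : countable (\bigcup_n V n).
  apply: bigcup_countable; first exact: countableP.
  by move=> n _; apply: finite_set_countable; have [] := hV n.
have [e [eV Ve]] := card_le_nat_enum _ _ cV.
exists e; split.
  move=> n; have [|[m _ Vm]] := eV n; [by left|right].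
  by have [VU _ _] := hV m; exact: VU.
rewrite -subTset -Vc => x [W /Ve[j _ <-] Wx].
by exists j.
Qed.

(** The diagonal argument against a uniform bound: on [G i] the covers defeat
    the selections of at most [i] sets. *)
Lemma S_bnd_locally_finite {X : topologicalType} (G : nat -> set X) :
  S_bnd (@open_covers X) (@open_covers X) ->
  (forall y, exists Q m, [/\ open Q, Q y &
     forall i, (m <= i)%N -> Q `&` G i = set0]) ->
  exists i, rothberger_in (G i).
Proof.
move=> bnd Gf; apply: contrapT => /forallNP nr.
have : forall i, exists A : nat -> set (set X),
    (forall n, open_covers (A n)) /\
    ~ exists F : nat -> set X, G i `<=` \bigcup_n F n /\
       forall n, F n = set0 \/ exists2 W, A n W & F n `<=` W.
  move=> i; move: (nr i) => /existsNP[A /not_implyP[Ac nA]].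
  by exists A.
move=> /choice[A hA].
(* Only the trace on the sets [G i] matters: a member of [C n] that meets
   [G i] refines the [i + 1] covers of the [n]-th block of the sequence [A i]. *)
pose C n := [set V : set X | open V /\ forall i, V `&` G i !=set0 ->
  forall j, (j <= i)%N -> exists2 W, A i (n * i.+1 + j)%N W & V `<=` W].
have Cc n : open_covers (C n).
  split=> [V []//|]; rewrite -subTset => y _.
  have [Q [m [Qo Qy QG]]] := Gf y.
  have : forall p : nat * nat, exists W,
      A p.1 (n * p.1.+1 + p.2)%N W /\ W y.
    move=> p; have [_ cov] := (hA p.1).1 (n * p.1.+1 + p.2)%N.
    by have : [set: X] y by []; rewrite -cov => -[W AW Wy]; exists W.
  move=> /choice[W hW].
  exists (Q `&` \bigcap_(i < m) \bigcap_(j < i.+1) W (i, j)).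
    split.
      apply: openI => //; apply: open_bigcap_nat => i; apply: open_bigcap_nat => j.
      by have [Ao _] := (hA i).1 (n * i.+1 + j)%N; exact: Ao (hW (i, j)).1.
    move=> i [z [[Qz _] Gz]] j ji.
    have im : (i < m)%N.
      by rewrite ltnNge; apply/negP => /QG QG0; have : set0 z by rewrite -QG0.
    exists (W (i, j)); first exact: (hW (i, j)).1.
    by move=> t [_]; apply.
  by split=> // i _ j _; exact: (hW (i, j)).2.
have [V [k [hV [_ Vc]]]] := bnd C Cc.
have : forall n, exists e : nat -> set X, (forall j, e j = set0 \/ V n (e j)) /\
    forall W, V n W -> exists2 j, (j < k)%N & e j = W.
  by move=> n; have [_ _ /card_le_nat_enum] := hV n.
move=> /choice[e he].
(* The at most [k] sets selected from [C n] are distributed over the [k + 1]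
   covers of the [n]-th block of [A k]; the last cover gets an empty set or a
   set left over by the enumeration. *)
apply: (hA k).2; exists (fun m => e (m %/ k.+1)%N (m %% k.+1)%N `&` G k); split.
  move=> z Gz; have : [set: X] z by [].
  rewrite -Vc => -[W [n _ VnW] Wz].
  have [j jk ej] := (he n).2 W VnW.
  have jk1 : (j < k.+1)%N by rewrite ltnS ltnW.
  exists (n * k.+1 + j)%N => //.
  by rewrite divnMDl// modnMDl modn_small// divn_small// addn0 ej.
move=> m; set n := (m %/ k.+1)%N; set j := (m %% k.+1)%N.
have [e0|Ve] := (he n).1 j; first by left; rewrite e0 set0I.
have [->|ne] := eqVneq (e n j `&` G k) set0; [by left|right].
have [VC _ _] := hV n; have [_ Ce] := VC _ Ve.
have jk : (j <= k)%N by rewrite -ltnS ltn_pmod.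
have [W AW eW] := Ce k ((set0P _).1 ne) j jk.
by exists W; [rewrite (divn_eq m k.+1)|move=> z [/eW]].
Qed.

(** A filter on [K] without cluster point yields the cover of [X] by the open
    sets whose complement is in the filter. A countable subcover [e] exists,
    and [K] has points outside any finite union of the [e j]. *)
Lemma noncompact_sequence {X : topologicalType} (K : set X) :
  S_bnd (@open_covers X) (@open_covers X) -> closed K -> ~ compact K ->
  exists x : nat -> X, (forall i, K (x i)) /\
    forall y, exists Q m, [/\ open Q, Q y & forall i, (m <= i)%N -> ~ Q (x i)].
Proof.
move=> bnd clK /existsNP[F /not_implyP[PF /not_implyP[FK /set0P/negP/negPn/eqP nK]]].
pose U := [set Q : set X | open Q /\ F (~` Q)].
have Uc : open_covers U.
  split=> [V []//|]; rewrite -subTset => y _.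
  have [Ky|nKy] := pselect (K y); last first.
    by exists (~` K) => //; split; [exact: closed_openC|rewrite setCK].
  have : ~ cluster F y by move=> cy; have : set0 y by rewrite -nK.
  move=> /existsNP[A /existsNP[B /not_implyP[FA /not_implyP[By AB]]]].
  move: By; rewrite nbhsE => -[Q [Qo Qy] QB].
  exists Q => //; split=> //; apply: filterS FA => z Az Qz.
  by apply: AB; exists z; split=> //; exact: QB.
have [e [eU ec]] := S_bnd_countable_subcover _ bnd Uc.
have Fe n : F (~` (e n)).
  by have [->|[]//] := eU n; rewrite setC0; exact: filterT.
have : forall i, exists x, K x /\ forall j, (j <= i)%N -> ~ e j x.
  move=> i; have : F (K `&` \bigcap_(j < i.+1) ~` e j).
    apply: filterI => //; rewrite bigcap_mkord; elim/big_ind: _ => [|? ? ? ?|j _].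
    - exact: filterT.
    - exact: filterI.
    - exact: Fe.
  by move=> /filter_ex[x [Kx ex]]; exists x.
move=> /choice[x hx]; exists x; split=> [i|y]; first exact: (hx i).1.
have : [set: X] y by [].
rewrite -ec => -[n _ eny].
exists (e n), n; split=> //; last by move=> i /(hx i).2.
by have [e0|[]//] := eU n; rewrite e0; exact: open0.
Qed.

(** Countable subcovers exist only for covers of the whole space, and the union
    [N] need not be closed; so [N] is first cut into the countably many closed
    sets [M m] of points at distance at least [1 / (m + 1)] from its
    complement. *)
Lemma S_bnd_rothberger_points {R : realType} {X : topologicalType}
    (d : X -> X -> R) :
  is_metric d -> generates_topology d ->
  S_bnd (@open_covers X) (@open_covers X) ->
  rothberger_in (\bigcup_(Q in [set Q : set X | open Q /\ rothberger_in Q]) Q).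
Proof.
move=> dm dg bnd; set N := \bigcup_(Q in _) Q.
have oN : open N by apply: bigcup_open => Q [].
pose M (m : nat) := [set x | dball d x m.+1%:R^-1 `<=` N].
have rM m : rothberger_in (M m).
  have Uc : open_covers [set Q : set X | open Q /\ rothberger_in (Q `&` M m)].
    split=> [V []//|]; rewrite -subTset => y _.
    have [My|] := pselect (M m y).
      have [|Q [Qo rO] Qy] := My y; first by apply: dball_center; rewrite ?invr_gt0.
      by exists Q => //; split=> //; apply: rothberger_in_sub rO => z [].
    move=> /existsNP[z /not_implyP[yz Nz]].
    exists (dball d z m.+1%:R^-1); last first.
      by case: dm => _ _ sym _; rewrite /dball /= sym.
    split; first exact: open_dball.
    rewrite (_ : _ `&` _ = set0); first exact: rothberger_in0.
    rewrite -subset0 => t [zt Mt]; apply: Nz; apply: Mt.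
    by case: dm => _ _ sym _; rewrite /dball /= sym.
  have [e [eU ec]] := S_bnd_countable_subcover _ bnd Uc.
  apply: (@rothberger_in_sub _ (\bigcup_n (e n `&` M m))).
    move=> x Mx; have : [set: X] x by [].
    by rewrite -ec => -[n _ enx]; exists n.
  apply: rothberger_in_bigcup => n; have [->|[]//] := eU n.
  by rewrite set0I; exact: rothberger_in0.
apply: (@rothberger_in_sub _ (\bigcup_m M m)); last exact: rothberger_in_bigcup.
move=> x Nx; have [r r0 xr] := (dg N).1 oN x Nx.
have [m hm] := invS_lt _ r0; exists m => // y xy; apply: xr.
by apply: lt_trans (hm m _).
Qed.

(** Since the radii tend to zero, a ball that meets a small ball about [y] has,
    for large [i], its centre in a given neighbourhood of [y]. *)
Lemma dball_invS_locally_finite {R : realType} {X : topologicalType}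
    (d : X -> X -> R) (x : nat -> X) :
  is_metric d -> generates_topology d ->
  (forall y, exists Q m, [/\ open Q, Q y & forall i, (m <= i)%N -> ~ Q (x i)]) ->
  forall y, exists Q m, [/\ open Q, Q y &
     forall i, (m <= i)%N -> Q `&` dball d (x i) i.+1%:R^-1 = set0].
Proof.
move=> dm dg xf y; have [Q [m [Qo Qy Qx]]] := xf y.
have [r r0 yr] := (dg Q).1 Qo y Qy.
have r20 : 0 < r / 2 by rewrite divr_gt0.
have [m' hm'] := invS_lt _ r20.
exists (dball d y (r / 2)), (maxn m m'); split; [exact: open_dball|exact: dball_center|].
move=> i; rewrite geq_max => /andP[mi mi'].
rewrite -subset0 => z [yz xz]; apply: (Qx i mi); apply: yr.
case: dm => _ _ sym tri; move: yz xz; rewrite /dball /= => yz xz.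
have {}xz := lt_trans xz (hm' i mi').
by have := tri y z (x i); rewrite (sym z (x i)); lra.
Qed.

(** The compact part consists of the points that have no open neighbourhood
    Rothberger in [X]. *)
Lemma S_bnd_decomposition {R : realType} {X : topologicalType} :
  metrizable R X -> S_bnd (@open_covers X) (@open_covers X) ->
  exists K N : set X, [/\ compact K, rothberger_in N & [set: X] = K `|` N].
Proof.
move=> [d [dm dg]] bnd.
pose N : set X := \bigcup_(Q in [set Q : set X | open Q /\ rothberger_in Q]) Q.
have oN : open N by apply: bigcup_open => Q [].
exists (~` N), N; split; last by rewrite setUC setUv.
- apply: contrapT => /(noncompact_sequence _ bnd (open_closedC oN))[x [Kx xf]].
  have [i ri] := S_bnd_locally_finite _ bnd (dball_invS_locally_finite _ _ dm dg xf).
  apply: (Kx i); exists (dball d (x i) i.+1%:R^-1).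
    by split=> //; exact: open_dball.
  by apply: dball_center; rewrite ?invr_gt0.
- exact: S_bnd_rothberger_points dm dg bnd.
Qed.

(** * A metric adapted to a sequence of open covers *)

(** Equicontinuity makes the uniform pseudometric of the family [h] continuous,
    so that adding it to [d] does not change the topology. *)
Lemma equicontinuous_metric {R : realType} {X : topologicalType} {I : Type}
    (i0 : I) (d : X -> X -> R) (h : I -> X -> R) :
  is_metric d -> generates_topology d ->
  (forall i x, 0 <= h i x <= 1) ->
  (forall x e, 0 < e -> exists2 r, 0 < r &
     forall y, d x y < r -> forall i, `|h i x - h i y| <= e) ->
  exists d' : X -> X -> R, [/\ is_metric d', generates_topology d' &
    forall i x y, `|h i x - h i y| <= d' x y].
Proof.
move=> dm dg h01 heq.
pose D x y := [set `|h i x - h i y| | i in [set: I]].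
have D0 x y : D x y !=set0 by exists `|h i0 x - h i0 y|, i0.
have hD i x y : `|h i x - h i y| <= sup (D x y).
  apply: ub_le_sup; last by exists i.
  exists 1 => _ [j _ <-]; rewrite ler_norml.
  by have := h01 j x; have := h01 j y; lra.
have supD_le x y e : (forall i, `|h i x - h i y| <= e) -> sup (D x y) <= e.
  by move=> he; apply: ge_sup => // _ [i _ <-].
have supD_ge0 x y : 0 <= sup (D x y) by apply: le_trans (hD i0 x y).
have [d_ge0 d_eq0 d_sym d_tri] := dm.
exists (fun x y => d x y + sup (D x y)); split.
- split=> [x y|x y|x y|x y z].
  + by rewrite addr_ge0.
  + split=> [/eqP|->]; first by rewrite paddr_eq0// => /andP[/eqP/d_eq0].
    rewrite (d_eq0 y y).2// add0r; apply/eqP; rewrite eq_le supD_ge0 andbT.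
    by apply: supD_le => i; rewrite subrr normr0.
  + rewrite d_sym; congr (_ + sup _); apply: eq_imagel => i _.
    exact: distrC.
  + have : sup (D x z) <= sup (D x y) + sup (D y z).
      apply: supD_le => i; apply: le_trans (ler_distD (h i y) _ _) _.
      exact: lerD.
    by have := d_tri x y z; lra.
- move=> A; split=> [Ao x Ax|Ad].
    have [e e0 xe] := (dg A).1 Ao x Ax; exists e => // y /= xy; apply: xe => /=.
    by have := supD_ge0 x y; lra.
  apply/dg => x /Ad[e e0 xe].
  have [r r0 xr] := heq x (e / 2) ltac:(lra).
  exists (Num.min r (e / 2)); first by rewrite lt_min r0 divr_gt0.
  move=> y /=; rewrite lt_min => /andP[xy xy']; apply: xe => /=.
  by have := supD_le _ _ _ (xr y xy); lra.
- by move=> i x y; have := hD i x y; have := d_ge0 x y; lra.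
Qed.

(** The value [r = 0] is allowed for an empty [U] as well, so that the supremum
    is always that of a nonempty set. *)
Definition lebesgue_radius {R : realType} {X : Type} (d : X -> X -> R)
    (U : set (set X)) (x : X) : R :=
  sup [set r | 0 <= r <= 1 /\
    (r = 0 \/ exists2 V, U V & dball d x r `<=` V)].

Lemma has_sup_lebesgue_radius {R : realType} {X : Type} (d : X -> X -> R)
    (U : set (set X)) (x : X) :
  has_sup [set r : R | 0 <= r <= 1 /\
    (r = 0 \/ exists2 V, U V & dball d x r `<=` V)].
Proof.
split; first by exists 0; rewrite /= lexx ler01; split=> //; left.
by exists 1 => r [/andP[]].
Qed.

Lemma lebesgue_radius_ge {R : realType} {X : Type} (d : X -> X -> R)
    (U : set (set X)) (x : X) (r : R) :
  r <= 0 \/ r <= 1 /\ (exists2 V, U V & dball d x r `<=` V) ->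
  r <= lebesgue_radius d U x.
Proof.
have hs := has_sup_lebesgue_radius d U x.
have ge0 : 0 <= lebesgue_radius d U x.
  by apply: (sup_upper_bound hs); rewrite /= lexx ler01; split=> //; left.
move=> [r0|[r1 UV]]; first exact: le_trans ge0.
have [r0|r0] := leP r 0; first exact: le_trans ge0.
by apply: (sup_upper_bound hs); rewrite /= r1 ltW//; split=> //; right.
Qed.

Lemma lebesgue_radius_ge0 {R : realType} {X : Type} (d : X -> X -> R)
    (U : set (set X)) (x : X) : 0 <= lebesgue_radius d U x.
Proof. by apply: lebesgue_radius_ge; left. Qed.

Lemma lebesgue_radius_gtP {R : realType} {X : Type} (d : X -> X -> R)
    (U : set (set X)) (x : X) (c : R) :
  0 <= c -> c < lebesgue_radius d U x ->
  exists V r, [/\ U V, c < r, r <= 1 & dball d x r `<=` V].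
Proof.
move=> c0 /(sup_gt (has_sup_lebesgue_radius d U x).1)[r [/andP[r0 r1] hr] cr].
case: hr => [r00|[V UV xV]]; first by move: cr; rewrite r00; lra.
by exists V, r.
Qed.

Lemma lebesgue_radius_sub {R : realType} {X : Type} (d : X -> X -> R)
    (U U' : set (set X)) (x : X) :
  U `<=` U' -> lebesgue_radius d U x <= lebesgue_radius d U' x.
Proof.
move=> UU'; rewrite leNgt; apply/negP.
move=> /(lebesgue_radius_gtP _ _ _ _ (lebesgue_radius_ge0 _ _ _)).
move=> [V [r [UV Vr r1 xV]]]; move: Vr; apply/negP; rewrite -leNgt.
by apply: lebesgue_radius_ge; right; split=> //; exists V => //; exact: UU'.
Qed.

Lemma lebesgue_radius_lipschitz {R : realType} {X : Type} (d : X -> X -> R)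
    (U : set (set X)) (x y : X) :
  is_metric d -> `|lebesgue_radius d U x - lebesgue_radius d U y| <= d x y.
Proof.
move=> [d_ge0 _ d_sym d_tri].
have half u v : lebesgue_radius d U u <= lebesgue_radius d U v + d u v.
  rewrite leNgt; apply/negP.
  have c0 := addr_ge0 (lebesgue_radius_ge0 d U v) (d_ge0 u v).
  move=> /(lebesgue_radius_gtP _ _ _ _ c0).
  move=> [V [r [UV + r1 uV]]]; apply/negP; rewrite -leNgt -lerBlDr.
  apply: lebesgue_radius_ge; right; split; first by have := d_ge0 u v; lra.
  exists V => // z /= vz; apply: uV; rewrite /dball /=.
  by have := d_tri u v z; move: vz; rewrite /dball /=; lra.
by rewrite ler_norml; have := half x y; have := half y x; rewrite (d_sym y x); lra.
Qed.

Lemma lebesgue_radius_gt0 {R : realType} {X : topologicalType}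
    (d : X -> X -> R) (U : set (set X)) (x : X) :
  generates_topology d -> open_covers U -> 0 < lebesgue_radius d U x.
Proof.
move=> dg [Uo Uc]; have : [set: X] x by [].
rewrite -Uc => -[V UV Vx]; have [e e0 xe] := (dg V).1 (Uo V UV) x Vx.
apply: (@lt_le_trans _ _ (Num.min e 1)); first by rewrite lt_min e0 ltr01.
apply: lebesgue_radius_ge; right; split; first by rewrite ge_min lexx orbT.
exists V => // y; rewrite /dball /= lt_min => /andP[xy _]; exact: xe.
Qed.

Lemma lebesgue_radius_setI1_gt0 {R : realType} {X : Type} (d : X -> X -> R)
    (U : set (set X)) (V : set X) (x : X) :
  is_metric d -> 0 < lebesgue_radius d (U `&` [set V]) x -> U V /\ V x.
Proof.
move=> dm /(lebesgue_radius_gtP _ _ _ _ (lexx _))[W [r [[UW WV] r0 _ xW]]].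
rewrite -WV; split=> //; apply: xW; exact: dball_center.
Qed.

Lemma lebesgue_radius_setI1_gt {R : realType} {X : Type} (d : X -> X -> R)
    (U : set (set X)) (x : X) (c : R) :
  0 <= c -> c < lebesgue_radius d U x ->
  exists2 V, U V & c < lebesgue_radius d (U `&` [set V]) x.
Proof.
move=> c0 /(lebesgue_radius_gtP _ _ _ _ c0)[V [r [UV cr r1 xV]]].
exists V => //; apply: lt_le_trans cr _.
by apply: lebesgue_radius_ge; right; split=> //; exists V.
Qed.

Lemma ratio_dist_le {R : realType} (a a' s s' D : R) :
  0 <= a' <= s' -> 0 < s -> 0 < s' -> `|a - a'| <= D -> `|s - s'| <= D ->
  `|a / s - a' / s'| <= D * 2 / s.
Proof.
move=> a's' s0 s'0 aD sD.
have -> : a / s - a' / s' = ((a - a') + a' / s' * (s' - s)) / s.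
  by field; rewrite !gt_eqF.
rewrite normrM normfV (gtr0_norm s0) ler_pM2r ?invr_gt0//.
apply: le_trans (ler_normD _ _) _.
have -> : D * 2 = D + D by ring.
apply: lerD => //; rewrite normrM distrC.
rewrite -[leRHS]mul1r; apply: ler_pM => //.
by rewrite ger0_norm ?divr_ge0 ?ler_pdivrMr ?mul1r; lra.
Qed.

(** Intersecting with [U] makes the function zero for [V] outside [U], so that a
    supremum over all the sets [V] is one over the members of [U]. *)
Definition normalized_radius {R : realType} {X : Type} (d : X -> X -> R)
    (U : set (set X)) (V : set X) (x : X) : R :=
  lebesgue_radius d (U `&` [set V]) x / lebesgue_radius d U x.

Lemma normalized_radius_bounds {R : realType} {X : topologicalType}
    (d : X -> X -> R) (U : set (set X)) (V : set X) (x : X) :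
  generates_topology d -> open_covers U -> 0 <= normalized_radius d U V x <= 1.
Proof.
move=> dg Uc; have s0 := lebesgue_radius_gt0 _ _ x dg Uc.
rewrite /normalized_radius divr_ge0 ?lebesgue_radius_ge0//=.
by rewrite ler_pdivrMr// mul1r; apply: lebesgue_radius_sub => ? [].
Qed.

(** The Lipschitz constant depends on [x] but not on [V]: this gives the
    equicontinuity of the family. *)
Lemma normalized_radius_dist_le {R : realType} {X : topologicalType}
    (d : X -> X -> R) (U : set (set X)) (V : set X) (x y : X) :
  is_metric d -> generates_topology d -> open_covers U ->
  `|normalized_radius d U V x - normalized_radius d U V y| <=
    d x y * 2 / lebesgue_radius d U x.
Proof.
move=> dm dg Uc; apply: ratio_dist_le.
- by rewrite lebesgue_radius_ge0; apply: lebesgue_radius_sub => ? [].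
- exact: lebesgue_radius_gt0.
- exact: lebesgue_radius_gt0.
- exact: lebesgue_radius_lipschitz.
- exact: lebesgue_radius_lipschitz.
Qed.

(** At [x] some quotient exceeds [1/2], since their supremum is [1]; where it
    remains positive, the point is still in [V]. *)
Lemma normalized_radius_large {R : realType} {X : topologicalType}
    (d : X -> X -> R) (U : set (set X)) (x : X) :
  is_metric d -> generates_topology d -> open_covers U ->
  exists2 V, U V & forall y,
    `|normalized_radius d U V x - normalized_radius d U V y| < 2^-1 -> V y.
Proof.
move=> dm dg Uc; have sx := lebesgue_radius_gt0 _ _ x dg Uc.
have [||V UV xV] := lebesgue_radius_setI1_gt d U x (lebesgue_radius d U x / 2).
- by rewrite divr_ge0 ?ltW.
- lra.
exists V => // y; have sy := lebesgue_radius_gt0 _ _ y dg Uc.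
have : 2^-1 < normalized_radius d U V x.
  by rewrite /normalized_radius ltr_pdivlMr// mulrC.
rewrite ltr_norml => vx /andP[_ vxy].
have : 0 < normalized_radius d U V y by lra.
rewrite /normalized_radius pmulr_lgt0 ?invr_gt0//.
by move=> pos; have [] := lebesgue_radius_setI1_gt0 _ _ _ _ dm pos.
Qed.

(** All the pseudometrics are handled in one family [h] indexed by pairs. The
    weights [w n] tend to zero, so equicontinuity at a point involves only
    finitely many covers. *)
Lemma covers_uniform_metric {R : realType} {X : topologicalType}
    (U : nat -> set (set X)) :
  metrizable R X -> (forall n, open_covers (U n)) ->
  exists (d : X -> X -> R) (r : nat -> R),
    [/\ is_metric d, generates_topology d, forall n, 0 < r n &
      forall n x, exists2 V, U n V & dball d x (r n) `<=` V].
Proof.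
move=> [d [dm dg]] Uc.
pose w n : R := n.+1%:R^-1.
have w0 n : 0 < w n by rewrite invr_gt0.
have w1 n : w n <= 1 by rewrite invf_le1// ler1n.
pose h (p : nat * set X) x := w p.1 * normalized_radius d (U p.1) p.2 x.
have nr n V x := normalized_radius_bounds d (U n) V x dg (Uc n).
have h01 p x : 0 <= h p x <= 1.
  have /andP[n0 n1] := nr p.1 p.2 x.
  by rewrite mulr_ge0 ?(ltW (w0 _))//= mulr_ile1// ltW.
have [|d' [dm' dg' hd']] := equicontinuous_metric (0%N, set0) d h dm dg h01.
  move=> x e e0; have [m wm] := invS_lt e e0.
  have [r r0 hr] : exists2 r, 0 < r & forall n y, (n < m)%N -> d x y < r ->
      forall V, `|h (n, V) x - h (n, V) y| <= e.
    elim: m {wm} => [|m [r r0 hr]]; first by exists 1.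
    have s0 := lebesgue_radius_gt0 d (U m) x dg (Uc m).
    exists (Num.min r (e * lebesgue_radius d (U m) x / 2)).
      by rewrite lt_min r0 divr_gt0// mulr_gt0.
    move=> n y; rewrite lt_min ltnS leq_eqVlt => nm /andP[xyr xye] V.
    case/orP: nm => [/eqP ->|nm]; last exact: hr.
    rewrite /h /= -mulrBr normrM (gtr0_norm (w0 _)).
    apply: le_trans (ler_piMl _ (w1 m)) _; first exact: normr_ge0.
    apply: le_trans (normalized_radius_dist_le _ _ _ _ _ dm dg (Uc m)) _.
    by rewrite ler_pdivrMr//; move: xye; rewrite ltr_pdivlMr//; exact: ltW.
  exists r => // y xy [n V]; have [mn|nm] := leqP m n; last exact: hr.
  have /andP[n0 n1] := nr n V x; have /andP[n0' n1'] := nr n V y.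
  rewrite /h /= -mulrBr normrM (gtr0_norm (w0 _)).
  apply: le_trans (ltW (wm n mn)); rewrite -[leRHS]mulr1 ler_pM2l//.
  by rewrite ler_norml; lra.
exists d', (fun n => w n / 2); split=> // [n|n x]; first by rewrite divr_gt0.
have [V UV xV] := normalized_radius_large _ _ x dm dg (Uc n).
exists V => // y xy; apply: xV; rewrite -(ltr_pM2l (w0 n)).
apply: le_lt_trans xy; apply: le_trans (hd' (n, V) x y).
by rewrite /h /= -mulrBr normrM (gtr0_norm (w0 _)).
Qed.

(** * From strong measure zero to bounded selections *)

Lemma strong_measure_zero_rothberger {R : realType} {X : topologicalType}
    (N : set X) :
  metrizable R X ->
  (forall d : X -> X -> R,
    is_metric d -> generates_topology d -> strong_measure_zero d N) ->
  rothberger_in N.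
Proof.
move=> mX smz U Uc.
have [d [r [dm dg r0 dr]]] := covers_uniform_metric U mX Uc.
have [F [NF Fr]] := smz d dm dg r r0.
exists F; split=> // n.
have [->|/set0P[x Fx]] := eqVneq (F n) set0; [by left|right].
have [V UV xV] := dr n x; exists V => // y Fy; apply: xV.
rewrite /dball /= -lte_fin; apply: le_lt_trans (Fr n).
rewrite /diameter le_max; apply/orP; right.
by apply: ereal_sup_ubound; exists x => //; exists y.
Qed.

Lemma S_bnd_compactU {X : topologicalType} (K N : set X) :
  compact K -> rothberger_in N -> [set: X] = K `|` N ->
  S_bnd (@open_covers X) (@open_covers X).
Proof.
move=> cK rN KN U Uc.
have [D [DU Df KD]] : exists D : set (set X),
    [/\ D `<=` U 0%N, finite_set D & K `<=` \bigcup_(V in D) V].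
  have [Uo UT] := Uc 0%N; apply: compact_finite_subcover => //.
  by rewrite UT.
have [F [NF FU]] := rN U Uc.
have : forall n, exists W, F n = set0 \/ U n W /\ F n `<=` W.
  by move=> n; have [F0|[W UW FW]] := FU n; [exists set0; left|exists W; right].
move=> /choice[W hW].
pose V n := [set A | n = 0%N /\ D A] `|` (U n `&` [set W n]).
have VU n : V n `<=` U n by move=> A [[-> /DU]|[]].
have VT : \bigcup_(A in \bigcup_n V n) A = [set: X].
  rewrite -subTset => x; rewrite KN => -[/KD[A DA Ax]|/NF[n _ Fx]].
    by exists A => //; exists 0%N => //; left.
  have [F0|[UW FW]] := hW n; first by move: Fx; rewrite F0.
  by exists (W n); [exists n => //; right|exact: FW].
have DWf n : finite_set (D `|` [set W n]) by rewrite finite_setU.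
have VDW n : V n `<=` D `|` [set W n].
  by move=> A [[_ DA]|[_ ->]]; [left|right].
have Vf n : finite_set (V n) by apply: sub_finite_set (DWf n).
have [k Vk] : exists k, forall n, (V n #<= `I_k)%card.
  have /finite_setP[k0 Vk0] := Vf 0%N; exists (maxn k0 1) => -[|n].
    by rewrite (card_le_eql Vk0) card_le_II leq_maxl.
  apply: (@card_le_trans _ _ _ `I_1); last by rewrite card_le_II leq_maxr.
  apply: (@card_le_trans _ _ _ [set W n.+1]).
    by apply: subset_card_le => A [[]|[]].
  by rewrite (card_le_eql card_set1).
exists V, k; split=> [n|]; first by split.
split=> [A [n _ /VU UA]|//].
by have [Uo _] := Uc n; exact: Uo.
Qed.

Theorem corollary5p11 (R : realType) (X : topologicalType)
    (hX : metrizable R X) :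
  S_bnd (@open_covers X) (@open_covers X) <->
  exists K N : set X,
    [/\ compact K,
        forall d : X -> X -> R,
          is_metric d -> generates_topology d -> strong_measure_zero d N
      & [set: X] = K `|` N].
Proof.
split=> [/(S_bnd_decomposition hX)[K [N [cK rN KN]]]|[K [N [cK smzN KN]]]].
  by exists K, N; split=> // d dm dg; exact: rothberger_strong_measure_zero.
exact: S_bnd_compactU cK (strong_measure_zero_rothberger _ hX smzN) KN.
Qed.
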